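(* Let $\sigma$ and $\mu$ be two positive measures on the real line, satisfying $\int_{\mathbb R}\frac{d\sigma(u)}{u^2+1}<\infty$ and $\int_{\mathbb R}\frac{d\mu(u)}{u^2+1}<\infty$, and for which the corresponding Hilbert spaces $\mathcal H(\sigma)$ and $\mathcal H(\mu)$ are separable. Let respectively $g_0,g_1,\ldots$ and $h_0,h_1,\ldots$ be orthonormal bases of these spaces. Denote $Z_n=Q_{g_n}$ in $L^2(\mathcal S'_{\mathbb R},\mathcal C,P_\sigma)$ and $W_n=Q_{h_n}$ in $L^2(\mathcal S'_{\mathbb R},\mathcal C,P_\mu)$. Then one gets on $\mathcal S'_{\mathbb R}$ two probability space structures (given by $P_\sigma$ and $P_\mu$), in which $Z_0,Z_1,\ldots$ and $W_0,W_1,\ldots$ are respectively orthonormal families. The Gaussian variables $Z_n$ and $W_m$ need not be independent with respect to either probability.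
   Context: $\mathcal S_{\mathbb R}$ is the space of real-valued Schwartz test functions on $\mathbb R$, $\mathcal S'_{\mathbb R}$ its dual (real-valued tempered distributions), $\mathcal C$ the cylinder $\sigma$-algebra of $\mathcal S'_{\mathbb R}$, and $\widehat s(u)=\int_{\mathbb R}e^{-iut}s(t)\,dt$ the Fourier transform. For a positive measure $\sigma$ with $\int_{\mathbb R}\frac{d\sigma(u)}{u^2+1}<\infty$, $P_\sigma$ is the unique probability measure on $(\mathcal S'_{\mathbb R},\mathcal C)$, given by the Bochner–Minlos theorem, such that $$e^{-\frac12\int_{\mathbb R}|\widehat s(u)|^2d\sigma(u)}=\int_{\mathcal S'_{\mathbb R}}e^{i\langle w,s\rangle}dP_\sigma(w),\quad s\in\mathcal S_{\mathbb R}.$$ $\mathcal H(\sigma)$ is the closure (Hilbert space completion) of $\mathcal S_{\mathbb R}$ endowed with the pre-Hilbert structure $\langle s_1,s_2\rangle_\sigma=\int_{\mathbb R}\overline{\widehat{s_1}(u)}\,\widehat{s_2}(u)\,d\sigma(u)$. For $s\in\mathcal S_{\mathbb R}$, $Q_s(w)=\langle w,s\rangle$ is, under $P_\sigma$, a centered Gaussian variable with variance $\int_{\mathbb R}|\widehat s(u)|^2d\sigma(u)$; the map $s\mapsto Q_s$ is an isometry from $\mathcal S_{\mathbb R}$ with this structure into $L^2(\mathcal S'_{\mathbb R},\mathcal C,P_\sigma)$, and it extends to an isometry, still denoted $Q$, defined on all of $\mathcal H(\sigma)$. The same construction and notation are used with $\mu$ in place of $\sigma$. *)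

(* Defs.v *)
From HB Require Import structures.
From mathcomp Require Import all_boot all_order all_algebra.
From mathcomp Require Import all_classical all_reals all_analysis.
From mathcomp Require Import sesquilinear complex.

Set Implicit Arguments.
Unset Strict Implicit.
Unset Printing Implicit Defensive.

Import Order.TTheory GRing.Theory Num.Theory.
Import numFieldNormedType.Exports.

Local Open Scope classical_set_scope.
Local Open Scope ring_scope.

(** * Real-valued Schwartz functions *)

Section schwartz_closed.
Context {R : realType}.
Implicit Types (f g : R -> R).

Definition smooth f := forall n t, derivable (derive1n n f) t 1.

Definition rapidly_decreasing f := forall k n, exists M : R,
  forall t, `|t ^+ k * derive1n n f t| <= M.

Definition is_schwartz : {pred R -> R} :=
  mem [set f | smooth f /\ rapidly_decreasing f].

Lemma derive1n_lin (a : R) f g n : smooth f -> smooth g ->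
  derive1n n (a *: f + g) = a *: derive1n n f + derive1n n g.
Proof.
move=> sf sg; elim: n => [//|n IHn].
rewrite !derive1nS IHn; apply/funext => t.
rewrite derive1E deriveD; [|exact/derivableZ/sf|exact: sg].
by rewrite deriveZ; [rewrite !fctE !derive1E|exact: sf].
Qed.

Lemma derive1n_cst0 n : derive1n n (0 : R -> R) = 0.
Proof.
elim: n => [//|n IHn]; rewrite derive1nS IHn.
by apply/funext => t; exact: derive1_cst.
Qed.

Lemma is_schwartz_submod_closed : submod_closed is_schwartz.
Proof.
split.
  rewrite inE; split=> [n t|k n]; rewrite derive1n_cst0.
    exact: derivable_cst.
  by exists 0 => t; rewrite mulr0 normr0.
move=> a f g; rewrite !inE => -[sf df] [sg dg]; split=> [n t|k n].
  rewrite derive1n_lin//; apply: derivableD; last exact: sg.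
  exact/derivableZ/sf.
have [M fM] := df k n; have [N gN] := dg k n.
exists (`|a| * M + N) => t; rewrite derive1n_lin// !fctE mulrDr.
rewrite (le_trans (ler_normD _ _))// lerD//.
by rewrite mulrCA normrM ler_wpM2l.
Qed.

HB.instance Definition _ :=
  GRing.isSubmodClosed.Build _ _ is_schwartz is_schwartz_submod_closed.

End schwartz_closed.

Record schwartz (R : realType) := Schwartz {
  schwartz_fun :> R -> R;
  schwartzP : schwartz_fun \in is_schwartz }.

HB.instance Definition _ (R : realType) :=
  [isSub of schwartz R for @schwartz_fun R].
HB.instance Definition _ (R : realType) := [Choice of schwartz R by <:].
HB.instance Definition _ (R : realType) :=
  [SubChoice_isSubLmodule of schwartz R by <:].
HB.instance Definition _ (R : realType) := isPointed.Build (schwartz R) 0.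

Definition schwartz_seminorm (R : realType) (k n : nat) (s : schwartz R) : R :=
  sup [set `|t ^+ k * derive1n n s t| | t in [set: R]].

Definition schwartz_ball (R : realType) (i : schwartz R * nat * nat * R) :
    set (schwartz R) :=
  let: (s0, k, n, e) := i in [set s | schwartz_seminorm k n (s - s0) < e].

HB.instance Definition _ (R : realType) :=
  isSubBaseTopological.Build (schwartz R) setT (@schwartz_ball R).

(** * Real-valued tempered distributions and the cylinder sigma-algebra *)

Record tempered (R : realType) := Tempered {
  tempered_fun :> {linear schwartz R -> R^o};
  tempered_continuous : continuous tempered_fun }.

Lemma null_tempered_continuous (R : realType) :
  continuous (\0 : schwartz R -> R^o).
Proof. exact: cst_continuous. Qed.

HB.instance Definition _ (R : realType) := gen_eqMixin (tempered R).
HB.instance Definition _ (R : realType) := gen_choiceMixin (tempered R).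
HB.instance Definition _ (R : realType) :=
  isPointed.Build (tempered R) (Tempered (@null_tempered_continuous R)).

Definition pairing (R : realType) (s : schwartz R) (w : tempered R) : R := w s.

Definition cylinders (R : realType) : set (set (tempered R)) :=
  \bigcup_(s in [set: schwartz R])
    preimage_set_system setT (pairing s) (@measurable _ (measurableTypeR R)).

Notation tempered_cyl R := (g_sigma_algebraType (@cylinders R)).

(** * Fourier transform and the form attached to a measure *)

Section fourier.
Context {R : realType}.
Local Open Scope complex_scope.

Definition expi (x : R) : R[i] := cos x +i* sin x.

Definition Cintegral d (T : measurableType d) (m : {measure set T -> \bar R})
    (f : T -> R[i]) : R[i] :=
  (\int[m]_x complex.Re (f x)) +i* (\int[m]_x complex.Im (f x)).

Definition fourier (s : schwartz R) (u : R) : R[i] :=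
  Cintegral (@lebesgue_measure R) (fun t => expi (- (u * t)) * (s t)%:C).

Variable sigma : {measure set (measurableTypeR R) -> \bar R}.

Definition admissible :=
  (\int[sigma]_u ((u ^+ 2 + 1)^-1)%:E < +oo)%E.

(* For a measure which is not invariant under u |-> - u the integral below can
   have a nonzero imaginary part.  The inner product of the real vector space of
   real Schwartz functions is its real part; it is the only real inner product
   with squared norm the integral of |fourier s|^2. *)
Definition spectral_dot (s1 s2 : schwartz R) : R :=
  complex.Re (Cintegral sigma (fun u => (fourier s1 u)^* * fourier s2 u)).

Definition spectral_sqnorm (s : schwartz R) : R :=
  \int[sigma]_u complex.Re (`|fourier s u| ^+ 2).

(* The defining property of the Bochner-Minlos measure of sigma. *)
Definition bochner_minlos (P : probability (tempered_cyl R) R) :=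
  forall s : schwartz R,
    Cintegral P (fun w => expi (pairing s w)) =
    (expR (- (2^-1 * spectral_sqnorm s)))%:C.

End fourier.

(** * Hilbert space completion *)

(* A completion consists of a complete space and of a linear map with dense
   range which preserves the (possibly degenerate) inner product; it is unique
   up to a unique isometric isomorphism compatible with these maps. *)
Record hilbert_completion (R : realType)
    (sigma : {measure set (measurableTypeR R) -> \bar R}) := HilbertCompletion {
  hilbert_space :> completeNormedModType R;
  hdot : {dot hilbert_space for idfun};
  hdot_norm : forall x, hdot x x = `|x| ^+ 2;
  embed : {linear schwartz R -> hilbert_space};
  embed_dot : forall s1 s2,
    hdot (embed s1) (embed s2) = spectral_dot sigma s1 s2;
  embed_dense : dense (range embed) }.

Definition separable (T : topologicalType) :=
  exists2 D : set T, countable D & dense D.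

Definition orthonormal_basis (R : realType)
    (sigma : {measure set (measurableTypeR R) -> \bar R})
    (H : hilbert_completion sigma) (I : countType) (g : I -> H) :=
  (forall i j, hdot H (g i) (g j) = (i == j)%:R) /\
  dense [set x : H | exists (r : seq I) (c : I -> R),
    x = \sum_(i <- r) c i *: g i].

(** * The isometry Q *)

Section isometry.
Context {R : realType} {sigma : {measure set (measurableTypeR R) -> \bar R}}.
Variables (H : hilbert_completion sigma) (P : probability (tempered_cyl R) R).

Definition is_Q (x : H) (Z : tempered_cyl R -> R) :=
  Z \in Lfun P 2%:E /\
  forall e : R, 0 < e -> \forall y \near x, forall s, embed H s = y ->
    ('N[P]_2%:E [EFin \o (Z \- pairing s)%R] < e%:E)%E.

(* A representative of the class of Q_x in L^2(P): the limit in L^2(P) of the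
   functions [pairing s] as the image of s in H tends to x. *)
Definition Q (x : H) : tempered_cyl R -> R := xget (cst 0) [set Z | is_Q x Z].

End isometry.

Definition orthonormal_L2 (R : realType) d (T : measurableType d)
    (P : probability T R) (I : eqType) (Z : I -> T -> R) :=
  (forall i, Z i \in Lfun P 2%:E) /\
  forall i j, \int[P]_w (Z i w * Z j w) = (i == j)%:R.

Definition independent (R : realType) d (T : measurableType d)
    (P : probability T R) (X Y : T -> R) :=
  forall A B : set R, measurable A -> measurable B ->
    (P (X @^-1` A `&` Y @^-1` B) = P (X @^-1` A) * P (Y @^-1` B))%E.

(* Main.v *)
Require Import Defs.
From HB Require Import structures.
From mathcomp Require Import all_boot all_order all_algebra.
From mathcomp Require Import all_classical all_reals all_analysis.
From mathcomp Require Import sesquilinear complex.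
From mathcomp Require Import measurable_realfun ring lra.

(* The squared norm of [s] in the completion is the spectral integral, so the
   characteristic functional of the Bochner-Minlos measure alone determines all
   the second moments: [E (X_s ^ 2) = |embed s| ^ 2] follows from
   [E (cos (l X_s)) = exp (- l^2 |embed s|^2 / 2)] by letting [l] tend to [0].
   Hence [s |-> X_s] is an isometry, [Q] exists by completeness of L^2, and
   orthonormality follows by polarization.  For the dependence statement, some
   [s0] is nonzero for both measures; its two normalizations are unit vectors, which reflections
   turn into members of orthonormal bases, and the corresponding pairings are
   proportional, non-constant variables, hence dependent under both
   probabilities. *)

Set Implicit Arguments.
Unset Strict Implicit.
Unset Printing Implicit Defensive.

Import Order.TTheory GRing.Theory Num.Theory.
Import numFieldNormedType.Exports.

Local Open Scope classical_set_scope.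
Local Open Scope ring_scope.

(** * Elementary estimates for sine and cosine *)

Section trig_bounds.
Context {R : realType}.
Implicit Types x : R.

Lemma ler_norm_sin x : `|sin x| <= `|x|.
Proof.
wlog x0 : x / 0 <= x => [hw|].
  have [/hw//|/ltW x0] := leP 0 x.
  by rewrite -normrN -sinN -(normrN x) hw// oppr_ge0.
move: x0; rewrite le_eqVlt => /predU1P[<-|x0]; first by rewrite sin0.
have [c _] := MVT (f := @sin R) x0 (fun c _ => is_derive_sin c)
  (continuous_subspaceT (@continuous_sin R)).
rewrite sin0 !subr0 => ->; rewrite normrM ler_piMl//; exact: cos_max.
Qed.

Lemma onemcosE x : 1 - cos x = 2 * sin (x / 2) ^+ 2.
Proof.
have -> : cos x = cos (x / 2 *+ 2) by rewrite -mulr_natr divfK.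
by rewrite cos_mulr2n sin2cos2; ring.
Qed.

Lemma onemcos_le x : 2 * (1 - cos x) <= x ^+ 2.
Proof.
have -> : x ^+ 2 = 4 * (x / 2) ^+ 2 by field.
have : sin (x / 2) ^+ 2 <= (x / 2) ^+ 2.
  by rewrite -(real_normK (num_real (sin _))) -[leRHS]real_normK ?num_real//
    lerXn2r ?nnegrE// ler_norm_sin.
rewrite onemcosE; lra.
Qed.

(** The terms are difference quotients of [t |-> sin (t * x)] at 0 along the harmonic sequence, so
    they tend to the derivative there. *)
Lemma cvg_sin_scaled x : n.+1%:R * sin (x / n.+1%:R) @[n --> \oo] --> x.
Proof.
have dx : is_derive (0 : R) 1 (fun t : R => sin (t * x)) x.
  apply: is_derive_eq; rewrite mul0r cos0. rewrite /GRing.scale/=; ring.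
have D : h^-1 *: (sin ((h *: 1 + 0) * x) - sin (0 * x)) @[h --> 0^'] --> x.
  by rewrite -[x in _ --> x](@derive_val _ _ _ _ _ _ _ dx); exact: ex_derive.
have h0 : (forall n, @harmonic R n != 0) /\ harmonic @ \oo --> (0 : R).
  by split; [move=> n; rewrite invr_eq0 pnatr_eq0|exact: cvg_harmonic].
apply: cvg_trans ((cvgr_dnbhsP _ _ _).1 D _ h0).
apply: near_eq_cvg; apply: nearW => n /=.
by rewrite invrK /GRing.scale/= mulr1 addr0 mul0r sin0 subr0 (mulrC x).
Qed.
End trig_bounds.

(** * Fatou's lemma under almost sure convergence *)

Section second_moment.
Context d (T : measurableType d) (R : realType).

(** The limit [g] agrees almost everywhere with the lower limit of [f n], to which Fatou's lemma
    applies; the integrals are then compared with [c] term by term. *)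
Lemma ae_fatou_cvg (mu : {measure set T -> \bar R}) (f : nat -> T -> R)
    (g : T -> R) (c : R^nat) (l : R) :
  (forall n, measurable_fun setT (f n)) -> measurable_fun setT g ->
  (forall n w, 0 <= f n w) -> (forall w, 0 <= g w) ->
  {ae mu, forall w, f n w @[n --> \oo] --> g w} ->
  (forall n, \int[mu]_w (f n w)%:E <= (c n)%:E)%E ->
  c @ \oo --> l ->
  (\int[mu]_w (g w)%:E <= l%:E)%E.
Proof.
move=> mf mg f0 g0 fg fc cl.
have mfE n : measurable_fun setT (EFin \o f n) by exact/measurable_EFinP.
have -> : (\int[mu]_w (g w)%:E = \int[mu]_w limn_einf (fun n => (f n w)%:E))%E.
  apply: ae_eq_integral => //; first exact/measurable_EFinP.
    rewrite (_ : (fun _ => _) =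
      -%E \o (fun w => limn_esup (fun n => - (f n w)%:E)%E))%E.
      apply: (measurableT_comp (@oppe_measurable R _)).
      apply: measurable_fun_limn_esup => n.
      exact: (measurableT_comp (@oppe_measurable R _) (mfE n)).
    by apply/funext => w /=; rewrite (limn_esupN (EFin \o f^~ w)) oppeK.
  apply: filterS fg => w fgw _.
  have h : (f n w)%:E @[n --> \oo] --> (g w)%:E.
    by apply: cvg_EFin => //; exact: nearW.
  by rewrite is_cvg_limn_einfE ?(cvg_lim _ h)//; apply/cvg_ex; exists (g w)%:E.
apply: (le_trans (fatou _ _ _ _)) => // [n w _|]; first by rewrite lee_fin.
have cE : (EFin \o c) @ \oo --> l%:E.
    by apply: cvg_EFin => //; exact: nearW.
rewrite -(cvg_lim _ cE)// -is_cvg_limn_einfE; last by apply/cvg_ex; exists l%:E.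
rewrite !limn_einf_lim; apply: lee_lim; [exact: is_cvg_einfs..|].
apply: nearW => n; apply: le_ereal_inf_tmp => _ [m /= nm <-].
by apply: le_trans (fc m); apply: ereal_inf_lbound; exists m.
Qed.

End second_moment.

(** * Second moment of a variable with Gaussian characteristic function *)

Section gaussian_charfun.
Context d (T : measurableType d) (R : realType) (P : probability T R).
Variables (X : T -> R) (v : R).
Hypothesis mX : measurable_fun setT X.
Hypothesis EcosX : forall l : R,
  \int[P]_w cos (l * X w) = expR (- (2^-1 * (l ^+ 2 * v))).

Lemma measurable_cos_scaled (l : R) :
  measurable_fun setT (fun w => cos (l * X w)).
Proof.
apply: (measurableT_comp (continuous_measurable_fun (@continuous_cos R))).
exact: measurable_funM.
Qed.

Lemma integrable_cos_scaled (l : R) :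
  P.-integrable setT (EFin \o (fun w => cos (l * X w))).
Proof.
apply: measurable_bounded_integrable => //.
- by rewrite [X in (X < _)%E]probability_setT ltry.
- exact: measurable_cos_scaled.
- by exists 1; split => // r r1 w _ /=; rewrite (le_trans (cos_max _))// ltW.
Qed.

Lemma integral_onemcos (l : R) :
  (\int[P]_w (1 - cos (l * X w))%:E =
   (1 - expR (- (2^-1 * (l ^+ 2 * v))))%:E)%E.
Proof.
have i1 : P.-integrable setT (EFin \o cst (1 : R)).
  exact: finite_measure_integrable_cst.
rewrite -EcosX; under eq_integral do rewrite EFinB.
rewrite integralB_EFin//; last exact: integrable_cos_scaled.
rewrite integral_cst// [X in (_ * X)%E]probability_setT mule1.
rewrite EFinB; congr (_ - _)%E.
by rewrite /Rintegral fineK//; apply: integrable_fin_num => //;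
  exact: integrable_cos_scaled.
Qed.

Hypothesis v0 : 0 <= v.

Let N n : R := n.+1%:R.

Let N0 n : 0 < N n. Proof. by rewrite /N ltr0n. Qed.

(** Equal to [(2 N sin (X / (2 N))) ^ 2]: it approximates [X ^ 2] from below, and its integral is
    explicit by the hypothesis on cosines. *)
Let f n w := 2 * N n ^+ 2 * (1 - cos ((N n)^-1 * X w)).

Let int_f n :
  (\int[P]_w (f n w)%:E =
   (2 * N n ^+ 2 * (1 - expR (- (2^-1 * ((N n)^-1 ^+ 2 * v)))))%:E)%E.
Proof.
rewrite /f; under eq_integral do rewrite EFinM.
rewrite ge0_integralZl_EFin//.
- by rewrite integral_onemcos EFinM.
- apply/measurable_EFinP; apply: measurable_funB => //.
  exact: measurable_cos_scaled.
- by rewrite mulr_ge0// sqr_ge0.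
Qed.

Let f0 n w : 0 <= f n w.
Proof. by rewrite /f mulr_ge0// ?mulr_ge0 ?sqr_ge0// subr_ge0 cos_le1. Qed.

Let mf n : measurable_fun setT (f n).
Proof.
by apply: measurable_funM => //; apply: measurable_funB => //;
  exact: measurable_cos_scaled.
Qed.

Let mX2 : measurable_fun setT (fun w => X w ^+ 2).
Proof. exact: measurable_funX. Qed.

Lemma second_moment_charfun : (\int[P]_w (X w ^+ 2)%:E = v%:E)%E.
Proof.
have le_v : (\int[P]_w (X w ^+ 2)%:E <= v%:E)%E.
  apply: (@ae_fatou_cvg _ _ _ P f _ (cst v)) => //.
  - by move=> w; exact: sqr_ge0.
  - apply: nearW => w.
    have -> : f ^~ w = fun n =>
        (n.+1%:R * sin (X w / 2 / n.+1%:R)) ^+ 2 * 4.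
      apply/funext => n; rewrite /f -/(N n) onemcosE.
      have -> : (N n)^-1 * X w / 2 = X w / 2 / N n by ring.
      by ring.
    have -> : X w ^+ 2 = (X w / 2) ^+ 2 * 4 by field.
    apply: cvgMl; under eq_fun do rewrite expr2; rewrite expr2.
    by apply: cvgM; exact: cvg_sin_scaled.
  - move=> n; rewrite int_f lee_fin.
    (* Here [1 - exp (- a) <= a], and the prefactor times [a] is exactly [v]. *)
    have := expR_ge1Dx (- (2^-1 * ((N n)^-1 ^+ 2 * v))).
    set a := 2^-1 * _ => ea.
    have -> : v = 2 * N n ^+ 2 * a by rewrite /a; field; rewrite gt_eqF.
    by rewrite ler_wpM2l ?mulr_ge0 ?sqr_ge0//; lra.
  - exact: cvg_cst.
have fin : (\int[P]_w (X w ^+ 2)%:E)%E \is a fin_num.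
  rewrite ge0_fin_numE ?(le_lt_trans le_v) ?ltry//.
  by apply: integral_ge0 => w _; rewrite lee_fin sqr_ge0.
apply/eqP; rewrite eq_le le_v/=.
rewrite -(fineK fin) lee_fin; set c := fine _.
(* [f n] lies below [X ^ 2], so its explicit integral is at most [c]. *)
have cE n : 2 * N n ^+ 2 * (1 - expR (- (2^-1 * ((N n)^-1 ^+ 2 * v)))) <= c.
  rewrite -lee_fin fineK// -int_f; apply: ge0_le_integral => //.
  - by move=> w _; rewrite lee_fin.
  - exact/measurable_EFinP.
  - exact/measurable_EFinP.
  - move=> w _; rewrite lee_fin /f.
    have := onemcos_le ((N n)^-1 * X w).
    have -> : X w ^+ 2 = N n ^+ 2 * ((N n)^-1 * X w) ^+ 2.
      by field; rewrite gt_eqF.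
    by move=> h; rewrite (mulrC 2) -mulrA ler_wpM2l ?sqr_ge0.
have c0 : 0 <= c.
  by rewrite fine_ge0// integral_ge0// => w _; rewrite lee_fin sqr_ge0.
(* The inequality [a <= (1 - exp (- a)) (1 + a)] turns [cE] into [v <= c (1 + a)] with
   [a = v / (2 N^2)]. The error is then weakened from order [N^-2] to [N^-1], so that the harmonic
   sequence gives the limit. *)
have vc n : v <= c + (c * v / 2) * (N n)^-1.
  have {cE} := cE n; set a := 2^-1 * _; set m := 2 * _ => cE.
  have m0 : 0 < m by rewrite /m mulr_gt0// exprn_gt0.
  have vE : v = m * a by rewrite /m /a; field; rewrite gt_eqF.
  have a0 : 0 <= a by apply: mulr_ge0 => //; apply: mulr_ge0; rewrite ?sqr_ge0.
  have ea : a <= (1 - expR (- a)) * (1 + a).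
    have : (1 + a) * expR (- a) <= 1.
      by rewrite -[leRHS](expRxMexpNx_1 a) ler_wpM2r ?expR_ge0 ?expR_ge1Dx.
    rewrite -subr_ge0 => h; rewrite -subr_ge0.
    by rewrite [X in 0 <= X](_ : _ = 1 - (1 + a) * expR (- a))//; ring.
  have va : v <= c * (1 + a).
    rewrite vE (le_trans (ler_wpM2l (ltW m0) ea))// mulrA ler_wpM2r//.
    by rewrite addr_ge0.
  apply: (le_trans va).
  have -> : c * (1 + a) = c + c * v / 2 * (N n)^-1 * (N n)^-1.
    by rewrite /a; ring.
  rewrite lerD2l ler_piMr ?invf_le1 ?/N ?ler1n// -/(N n).
  by rewrite !mulr_ge0 ?invr_ge0// ltW.
have : c + (c * v / 2) * (N n)^-1 @[n --> \oo] --> c + (c * v / 2) * 0.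
  by apply: cvgD; [exact: cvg_cst|apply: cvgMr; exact: cvg_harmonic].
rewrite mulr0 addr0 => /cvgr_to_ge; apply; exact: nearW.
Qed.

Lemma integrable_sqr_charfun : P.-integrable setT (EFin \o (fun w => X w ^+ 2)).
Proof.
apply/integrableP; split; first exact/measurable_EFinP.
under eq_integral do rewrite /= ger0_norm ?sqr_ge0//.
by rewrite second_moment_charfun ltry.
Qed.

(** If [v > 0] and [X] takes only the values [sqrt v] and [- sqrt v], then at the frequency
    [l = 2 pi / sqrt v] the cosine is almost surely 1, whereas its mean [exp (- l^2 v / 2)] is less
    than 1. *)
Lemma sqr_ae_cst_charfun : {ae P, forall w, X w ^+ 2 = v} -> v = 0.
Proof.
move=> Xv; apply/eqP; rewrite eq_le v0 andbT leNgt; apply/negP => v_gt0.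
have sv0 : 0 < Num.sqrt v by rewrite sqrtr_gt0.
pose l := pi *+ 2 / Num.sqrt v.
have l0 : 0 < l by rewrite divr_gt0// mulrn_wgt0// pi_gt0.
have : \int[P]_w cos (l * X w) = 1.
  rewrite /Rintegral (ae_eq_integral (cst 1%E))//.
  - by rewrite integral_cst// [X in (_ * X)%E]probability_setT mule1.
  - by apply/measurable_EFinP; exact: measurable_cos_scaled.
  - apply: filterS Xv => w Xwv _; congr EFin.
    have : X w ^+ 2 = Num.sqrt v ^+ 2 by rewrite sqr_sqrtr.
    move/eqP; rewrite eqf_sqr => /orP[] /eqP ->.
      by rewrite divfK ?gt_eqF// cos2pi.
    by rewrite mulrN cosN divfK ?gt_eqF// cos2pi.
rewrite EcosX => /eqP; apply/negP; rewrite lt_eqF// expR_lt1.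
by rewrite oppr_lt0 mulr_gt0 ?invr_gt0// mulr_gt0// exprn_gt0.
Qed.

End gaussian_charfun.

(** * Dependence of proportional Gaussian variables *)

Section independence.
Context d (T : measurableType d) (R : realType) (P : probability T R).

Lemma ae_ge0_integral0_eq0 (g : T -> R) : P.-integrable setT (EFin \o g) ->
  {ae P, forall w, 0 <= g w} -> (\int[P]_w (g w)%:E = 0)%E ->
  {ae P, forall w, g w = 0}.
Proof.
move=> ig g0 ig0; have mg := measurable_int _ ig.
suff /(ae_eq_integral_abs _ measurableT mg) : (\int[P]_w `|(g w)%:E| = 0)%E.
  by apply: filterS => w /(_ I) [].
rewrite -[RHS]ig0; apply: ae_eq_integral => //.
  exact: measurableT_comp.
by apply: filterS g0 => w gw _ /=; rewrite ger0_norm.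
Qed.

(* A variable independent of a nonzero multiple of itself generates a trivial
   sigma-algebra, so its square is almost surely equal to its mean [v]. *)
Lemma not_independent_scaled (X : T -> R) (v a b : R) :
  measurable_fun setT X ->
  (forall l : R, \int[P]_w cos (l * X w) = expR (- (2^-1 * (l ^+ 2 * v)))) ->
  0 < v -> a != 0 -> b != 0 ->
  ~ independent P (fun w => a * X w) (fun w => b * X w).
Proof.
move=> mX EcosX v0 a0 b0 ind.
have iX2 := integrable_sqr_charfun mX EcosX (ltW v0).
have EX2 := second_moment_charfun mX EcosX (ltW v0).
have iv : P.-integrable setT (EFin \o cst v).
  exact: finite_measure_integrable_cst.
(* [E] is the preimage of a Borel set under each of the two multiples, so independence yields
   [P E = P E * P E], that is, [P E] is 0 or 1. *)
pose E := [set w | v < X w ^+ 2].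
have mS (c : R) : measurable [set x : R | v < (x / c) ^+ 2].
  have mf : measurable_fun setT (fun x : R => (x / c) ^+ 2).
    by apply: measurable_funX; exact: measurable_funM.
  rewrite (_ : [set x | _] = setT `&` (fun x => (x / c) ^+ 2) @^-1` `]v, +oo[).
    exact: mf.
  by apply/seteqP; split => x /=; rewrite in_itv/= andbT//; case.
have EE (c : R) : c != 0 ->
    (fun w => c * X w) @^-1` [set x : R | v < (x / c) ^+ 2] = E.
  by move=> c0; apply/funext => w; rewrite /E/= mulrAC divff// mul1r.
have := ind _ _ (mS a) (mS b); rewrite !EE// setIid => PE.
have mE : measurable E.
  rewrite -(EE 1 (oner_neq0 _)) -[X in measurable X]setTI.
  by apply: measurable_funM.
have Pfin : P E \is a fin_num by exact: fin_num_measure.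
have EY : (\int[P]_w (X w ^+ 2 - v)%:E = 0)%E.
  under eq_integral do rewrite EFinB.
  rewrite integralB_EFin// EX2 integral_cst//.
  by rewrite [X in (_ * X)%E]probability_setT mule1 subee.
suff /(sqr_ae_cst_charfun mX EcosX (ltW v0)) : {ae P, forall w, X w ^+ 2 = v}.
  by move/eqP; rewrite gt_eqF.
move: PE; rewrite -(fineK Pfin) -EFinM => -[] /eqP.
rewrite -subr_eq0 -{1}(mulr1 (fine _)) -mulrBr mulf_eq0 subr_eq0.
(* In both cases [X ^ 2 - v] has almost surely a constant sign and mean zero, hence vanishes almost
   surely. *)
move=> /orP[/eqP p0|/eqP p1].
- have : {ae P, forall w, v - X w ^+ 2 = 0}.
    apply: ae_ge0_integral0_eq0.
    + exact: (integrableB _ iv iX2).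
    + exists E; split => //; first by rewrite -(fineK Pfin) p0.
      by move=> w /= /negP; rewrite subr_ge0 -ltNge.
    + under eq_integral do rewrite EFinB.
      rewrite integralB_EFin// EX2 integral_cst//.
      rewrite [X in (X - _)%E]muleC [X in (X * _)%E]probability_setT.
      by rewrite mul1e subee.
  by apply: filterS => w /eqP; rewrite subr_eq0 => /eqP.
- have : {ae P, forall w, X w ^+ 2 - v = 0}.
    apply: ae_ge0_integral0_eq0 => //.
    + exact: (integrableB _ iX2 iv).
    + exists (~` E); split => //; first exact: measurableC.
        by rewrite probability_setC// -(fineK Pfin) -p1 subee.
      move=> w /= /negP; rewrite subr_ge0 -ltNge => /ltW h.
      by apply/negP; rewrite -leNgt.
  by apply: filterS => w /eqP; rewrite subr_eq0 => /eqP.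
Qed.

End independence.

(** * Reflections for a real inner product *)

Section householder.
Context (R : realType) (V : lmodType R) (f : {dot V for idfun}).
Implicit Types x y w : V.

Lemma dotC x y : f x y = f y x.
Proof. by rewrite hermC expr0 mul1r. Qed.

(* The reflection along [w]; it is the identity when [w = 0] since [0^-1 = 0]. *)
Definition householder w x : V := x - (2 * f x w / f w w) *: w.

Lemma householder_is_linear w : linear (householder w).
Proof.
move=> a x y; rewrite /householder linearPl/= scalerBr scalerA.
rewrite addrACA -opprD -scalerDl; congr (_ - _ *: _).
by rewrite /GRing.scale/=; ring.
Qed.

HB.instance Definition _ w :=
  GRing.isLinear.Build R V V _ (householder w) (householder_is_linear w).

Lemma householder_dot w x y : f (householder w x) (householder w y) = f x y.
Proof.
rewrite /householder; have [->|w0] := eqVneq w 0.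
  by rewrite !scaler0 !subr0.
have fw : f w w != 0 by rewrite gt_eqF// neq0_dnorm_gt0.
rewrite !linearBl/= !linearBr/= !linearZl_LR/= !linearZr_LR/= (dotC w y).
rewrite /GRing.scale/=. by field.
Qed.

Lemma householderK w : involutive (householder w).
Proof.
move=> x; have [->|w0] := eqVneq w 0.
  by rewrite /householder !scaler0 !subr0.
have fw : f w w != 0 by rewrite gt_eqF// neq0_dnorm_gt0.
have fh : f (householder w x) w = - f x w.
  rewrite /householder linearBl linearZl_LR/= /GRing.scale/=; by field.
rewrite {1}/householder fh mulrN mulNr scaleNr opprK.
by rewrite /householder subrK.
Qed.

(** Equal norms give [f (x - y) (x - y) = 2 * f x (x - y)], so the coefficient of [x - y] in the
    reflection is 1. *)
Lemma householder_swap x y : f x x = f y y -> householder (x - y) x = y.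
Proof.
move=> fxy; have [xy|xy] := eqVneq (x - y) 0.
  by rewrite /householder xy scaler0 subr0; apply/eqP; rewrite -subr_eq0 xy.
have fw : f (x - y) (x - y) != 0 by rewrite gt_eqF// neq0_dnorm_gt0.
rewrite /householder [X in X *: _](_ : _ = 1) ?scale1r ?subKr//.
move: fw; rewrite !linearBl/= !linearBr/= (dotC y x) -fxy => fw.
by field; move: fw; rewrite (_ : _ - _ = 2 * (f x x - f x y)); [|ring].
Qed.

End householder.

(** * Orthonormal bases through a prescribed unit vector *)

Section bases.
Context (R : realType) (sigma : {measure set (measurableTypeR R) -> \bar R}).
Variable H : hilbert_completion sigma.

Lemma hdotE (x y : H) :
  hdot H x y = 2^-1 * (`|x + y| ^+ 2 - `|x| ^+ 2 - `|y| ^+ 2).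
Proof.
rewrite -!hdot_norm !linearDl/= !linearDr/= (dotC _ y x); by field.
Qed.

Lemma householder_norm (w x : H) : `|householder (hdot H) w x| = `|x|.
Proof.
by apply/eqP; rewrite -(@eqrXn2 _ 2)// -!hdot_norm householder_dot.
Qed.

Lemma householder_continuous (w : H) : continuous (householder (hdot H) w).
Proof.
move=> x; apply/cvgrPdist_lt => e e0.
near=> y; rewrite -linearB householder_norm.
by near: y; exact: cvgr_dist_lt.
Unshelve. all: by end_near. Qed.

(** The reflection along [g n - x] carries [g n] to [x] and preserves inner products. Being a
    continuous linear involution, it also carries the dense span of [g] to a dense span. *)
Lemma orthonormal_basis_through (I : countType) (g : I -> H) (n : I) (x : H) :
  orthonormal_basis g -> `|x| = 1 ->
  exists g' : I -> H, orthonormal_basis g' /\ g' n = x.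
Proof.
move=> [gg dg] x1; pose U := householder (hdot H) (g n - x).
exists (U \o g); split; last first.
  by apply: householder_swap; rewrite gg hdot_norm x1 expr1n eqxx.
split=> [i j|O [y Oy] oO]; first by rewrite /= householder_dot.
have [||z [Oz [r [c zE]]]] := dg (U @^-1` O).
- by exists (U y) => /=; rewrite /U householderK.
- by apply: open_comp => // ? _; exact: householder_continuous.
exists (U z); split=> //; exists r, c; rewrite zE /U linear_sum.
by apply: eq_bigr => i _; rewrite linearZ.
Qed.

End bases.

(** * The L^2 norm in terms of integrals of squares *)

Section L2.
Context d (T : measurableType d) (R : realType) (P : {measure set T -> \bar R}).

Lemma Lnorm2E (f : T -> R) :
  ('N[P]_2%:E[EFin \o f] = (\int[P]_w (f w ^+ 2)%:E) `^ 2^-1)%E.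
Proof.
rewrite unlock; congr (_ `^ _)%E; apply: eq_integral => w _ /=.
by rewrite powR_mulrn// real_normK// num_real.
Qed.

Lemma Lnorm2_sqr (f : T -> R) (a : R) : 0 <= a ->
  (\int[P]_w (f w ^+ 2)%:E = (a ^+ 2)%:E)%E -> ('N[P]_2%:E[EFin \o f] = a%:E)%E.
Proof.
move=> a0; rewrite Lnorm2E => ->; rewrite poweR_EFin -powR_mulrn//.
by rewrite -powRrM divff// powRr1.
Qed.

Lemma Lnorm2_le (f : T -> R) (a : R) : 0 <= a ->
  (\int[P]_w (f w ^+ 2)%:E <= (a ^+ 2)%:E)%E -> ('N[P]_2%:E[EFin \o f] <= a%:E)%E.
Proof.
move=> a0 fa; rewrite Lnorm2E.
have -> : a%:E = ((a ^+ 2)%:E `^ 2^-1)%E.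
  by rewrite poweR_EFin -powR_mulrn// -powRrM divff// powRr1.
have I0 : (0 <= \int[P]_w (f w ^+ 2)%:E)%E.
  by apply: integral_ge0 => w _; rewrite lee_fin sqr_ge0.
by apply: gt0_ler_poweR => //; rewrite in_itv/= leey ?andbT ?lee_fin ?sqr_ge0.
Qed.

Lemma integral_sqr_Lnorm2 (f : T -> R) (a : R) :
  ('N[P]_2%:E[EFin \o f] = a%:E)%E -> (\int[P]_w (f w ^+ 2)%:E = (a ^+ 2)%:E)%E.
Proof.
have I0 : (0 <= \int[P]_w (f w ^+ 2)%:E)%E.
  by apply: integral_ge0 => w _; rewrite lee_fin sqr_ge0.
move=> fa; have a0 : 0 <= a by rewrite -lee_fin -fa Lnorm_ge0.
rewrite -powR_mulrn// -poweR_EFin -fa Lnorm2E -poweRrM mulVf//.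
by rewrite poweRe1.
Qed.

Lemma Lnorm2D (f g : T -> R) : measurable_fun setT f -> measurable_fun setT g ->
  ('N[P]_2%:E[EFin \o (f \+ g)%R] <=
   'N[P]_2%:E[EFin \o f] + 'N[P]_2%:E[EFin \o g])%E.
Proof. by move=> mf mg; apply: minkowski_EFin; rewrite ?lerDl. Qed.

Lemma Lnorm2BC (f g : T -> R) :
  ('N[P]_2%:E[EFin \o (f \- g)%R] = 'N[P]_2%:E[EFin \o (g \- f)%R])%E.
Proof.
by rewrite !Lnorm2E; congr (_ `^ _)%E; apply: eq_integral => w _ /=;
  rewrite -sqrrN opprB.
Qed.

Lemma mem_Lfun2 (f : T -> R) : measurable_fun setT f ->
  ('N[P]_2%:E[EFin \o f] < +oo)%E -> f \in Lfun P 2%:E.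
Proof. by move=> mf Nf; rewrite inE; apply/andP; split; rewrite inE. Qed.

Lemma Lfun2_measurable (f : T -> R) : f \in Lfun P 2%:E -> measurable_fun setT f.
Proof. by rewrite inE => /andP[/[!inE]]. Qed.

End L2.

(** * Second moments of the pairings under a Bochner-Minlos measure *)

Section pairing.
Context (R : realType).

Lemma measurable_pairing (s : schwartz R) :
  measurable_fun setT (pairing s : tempered_cyl R -> R).
Proof.
move=> _ B mB; apply: sub_sigma_algebra; exists s => //.
by exists B.
Qed.

Lemma pairingZ (a : R) (s : schwartz R) (w : tempered R) :
  pairing (a *: s) w = a * pairing s w.
Proof. by rewrite /pairing linearZ. Qed.

Lemma pairingD (s t : schwartz R) (w : tempered R) :
  pairing (s + t) w = pairing s w + pairing t w.
Proof. by rewrite /pairing linearD. Qed.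

Lemma pairingB (s t : schwartz R) (w : tempered R) :
  pairing (s - t) w = pairing s w - pairing t w.
Proof. by rewrite /pairing linearB. Qed.

Variable sigma : {measure set (measurableTypeR R) -> \bar R}.
Variables (H : hilbert_completion sigma) (P : probability (tempered_cyl R) R).
Hypothesis hP : bochner_minlos sigma P.

Lemma spectral_sqnormE (s : schwartz R) :
  spectral_sqnorm sigma s = `|embed H s| ^+ 2.
Proof.
rewrite -hdot_norm embed_dot /spectral_sqnorm /spectral_dot.
by apply: eq_Rintegral => u _; rewrite sqr_normc mulrC.
Qed.

(** This is the real part of the Bochner-Minlos identity at [l *: s]. *)
Lemma expectation_cos_pairing (s : schwartz R) (l : R) :
  \int[P]_w cos (l * pairing s w) =
  expR (- (2^-1 * (l ^+ 2 * `|embed H s| ^+ 2))).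
Proof.
have [+ _] := hP (l *: s); rewrite spectral_sqnormE (linearZ_LR (embed H)).
rewrite normrZ exprMn.
rewrite real_normK ?num_real// => <-.
by apply: eq_Rintegral => w _ /=; rewrite pairingZ.
Qed.

Lemma second_moment_pairing (s : schwartz R) :
  (\int[P]_w (pairing s w ^+ 2)%:E = (`|embed H s| ^+ 2)%:E)%E.
Proof.
apply: second_moment_charfun; first exact: measurable_pairing.
  exact: expectation_cos_pairing.
exact: sqr_ge0.
Qed.

Lemma Lnorm_pairing (s : schwartz R) :
  ('N[P]_2%:E[EFin \o pairing s] = `|embed H s|%:E)%E.
Proof. exact: Lnorm2_sqr (second_moment_pairing s). Qed.
End pairing.

(** * Almost sure convergence from summable increments *)

Section ae_convergence.
Context d (T : measurableType d) (R : realType) (P : probability T R).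

(** A coarse substitute for Cauchy-Schwarz: integrating [|f| <= p + f^2 / p] gives at most
    [p + p^3], which is at most [2 p] since [p <= 1]. *)
Lemma integral_norm_le_sqr (f : T -> R) (p : R) : measurable_fun setT f ->
  0 < p <= 1 -> (\int[P]_w (f w ^+ 2)%:E <= ((p ^+ 2) ^+ 2)%:E)%E ->
  (\int[P]_w `|f w|%:E <= (p *+ 2)%:E)%E.
Proof.
move=> mf /andP[p0 p1] f2.
have mf2 : measurable_fun setT (fun w => f w ^+ 2) by exact: measurable_funX.
have h w : `|f w| <= p + p^-1 * f w ^+ 2.
  rewrite -(real_normK (num_real (f w))).
  rewrite -(ler_pM2r p0) mulrDl mulrAC mulVf ?gt_eqF// mul1r.
  by have := sqr_ge0 (p - `|f w|); have := sqr_ge0 `|f w|; have := sqr_ge0 p;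
    rewrite sqrrB; nra.
have mg : measurable_fun setT (fun w => p + p^-1 * f w ^+ 2).
  by apply: measurable_funD => //; exact: measurable_funM.
apply: (@le_trans _ _ (\int[P]_w (p + p^-1 * f w ^+ 2)%:E)%E).
  apply: ge0_le_integral => //.
  - exact/measurable_EFinP/measurableT_comp.
  - exact/measurable_EFinP.
  - by move=> w _; rewrite lee_fin.
under eq_integral do rewrite EFinD EFinM.
rewrite ge0_integralD//; first last.
- by apply: measurable_funeM; exact/measurable_EFinP.
- by move=> w _; rewrite mule_ge0// lee_fin ?sqr_ge0// invr_ge0 ltW.
- by move=> w _; rewrite lee_fin ltW.
rewrite integral_cst// [X in (_ * X + _)%E]probability_setT mule1.
rewrite ge0_integralZl_EFin//; last 3 first.
- by move=> w _; rewrite lee_fin sqr_ge0.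
- exact/measurable_EFinP.
- by rewrite invr_ge0 ltW.
rewrite mulr2n EFinD leeD2l//.
apply: (@le_trans _ _ (p^-1%:E * ((p ^+ 2) ^+ 2)%:E)%E).
  by apply: lee_wpmul2l => //; rewrite lee_fin invr_ge0 ltW.
rewrite -EFinM lee_fin (_ : _ * _ = p * p ^+ 2); last by field; rewrite gt_eqF.
by rewrite ler_piMr ?(ltW p0)// expr_le1// ltW.
Qed.

(** The sum of the absolute increments has a finite integral, so it is almost surely finite; the
    telescoping series then converges absolutely. *)
Lemma ae_cvgn_summable_increments (X : nat -> T -> R) (c : R) :
  (forall n, measurable_fun setT (X n)) ->
  (forall n, \int[P]_w `|X n.+1 w - X n w|%:E <= (c / (2 ^ n.+1)%:R)%:E)%E ->
  {ae P, forall w, cvgn (X ^~ w)}.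
Proof.
move=> mX Xc.
pose D n w : R := `|X n.+1 w - X n w|.
have D0 n w : 0 <= D n w by exact: normr_ge0.
have mD n : measurable_fun setT (EFin \o D n).
  by apply/measurable_EFinP/measurableT_comp => //; exact: measurable_funB.
pose S w : \bar R := (\sum_(0 <= n <oo) (D n w)%:E)%E.
have iS : P.-integrable setT S.
  apply/integrableP; split.
    apply: ge0_emeasurable_sum => [n w _ _|n _]; last exact: mD.
    by rewrite lee_fin D0.
  have S0 w : (0 <= S w)%E by apply: nneseries_ge0 => n _ _; rewrite lee_fin D0.
  under eq_integral do rewrite gee0_abs//.
  rewrite integral_nneseries//; last by move=> n w _; rewrite lee_fin D0.
  apply: (@le_lt_trans _ _ (\sum_(0 <= n <oo) (c / (2 ^ (n + 1))%:R)%:E)%E).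
    apply: lee_nneseries => [n _ _|n _]; last by rewrite addn1; exact: Xc.
    by apply: integral_ge0 => w _; rewrite lee_fin D0.
  by rewrite (cvg_lim _ (@cvg_geometric_eseries_half _ c 0))// ltry.
apply: filterS (integrable_ae measurableT iS) => w /(_ I) Sfin.
have : cvgn (series (fun n => X n.+1 w - X n w)).
  apply: normed_cvg; apply: nondecreasing_is_cvgn.
    by apply: nondecreasing_series => n _ _; exact: normr_ge0.
  exists (fine (S w)) => _ [n _ <-].
  rewrite -lee_fin fineK// /series/= -sumEFin.
  by apply: nneseries_lim_ge => k _ _; rewrite lee_fin D0.
move=> /(is_cvgD (is_cvg_cst (X 0%N w))).
rewrite (_ : _ + _ = X ^~ w)//; apply/funext => n /=.
by rewrite fctE /series/= telescope_sumr// subrKC.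
Qed.

End ae_convergence.

(** * Existence of [Q] and its isometry property *)

Section isometry.
Context (R : realType) (sigma : {measure set (measurableTypeR R) -> \bar R}).
Variables (H : hilbert_completion sigma) (P : probability (tempered_cyl R) R).
Hypothesis hP : bochner_minlos sigma P.
Implicit Types (x y : H) (Z W : tempered_cyl R -> R).

Lemma embed_approx x (e : R) : 0 < e -> exists s, `|x - embed H s| < e.
Proof.
move=> e0; have [||y [xy [s _ sy]]] := @embed_dense _ _ H (ball x e).
- by exists x; exact: ballxx.
- exact: ball_open.
by exists s; rewrite sy; move: xy; rewrite -ball_normE.
Qed.

Lemma measurable_sub_pairing Z (s : schwartz R) : measurable_fun setT Z ->
  measurable_fun setT (Z \- pairing s).
Proof. by move=> mZ; apply: measurable_funB => //; exact: measurable_pairing. Qed.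

Lemma measurable_pairing_sub Z (s : schwartz R) : measurable_fun setT Z ->
  measurable_fun setT ((pairing s : tempered_cyl R -> R) \- Z).
Proof. by move=> mZ; apply: measurable_funB => //; exact: measurable_pairing. Qed.

Lemma integral_sqr_pairingB (s t : schwartz R) :
  (\int[P]_w ((pairing s w - pairing t w) ^+ 2)%:E =
   (`|embed H s - embed H t| ^+ 2)%:E)%E.
Proof.
rewrite -linearB -(second_moment_pairing H hP).
by apply: eq_integral => w _; rewrite pairingB.
Qed.

(* The limit is taken along Schwartz functions approximating [x] so fast that
   their pairings converge almost surely; Fatou's lemma does the rest. *)
Lemma exists_L2_limit x :
  exists2 Z : tempered_cyl R -> R, measurable_fun setT Z &
  forall s : schwartz R, (\int[P]_w ((Z w - pairing s w) ^+ 2)%:E <=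
             (`|x - embed H s| ^+ 2)%:E)%E.
Proof.
(* With [p = 2 ^- n.+1] and [q n = p ^ 2], approximation within [q n / 2] keeps consecutive pairings
   within [p ^ 2] in L^2, hence within [2 p] in L^1, which is summable. *)
pose q n : R := (2 ^- n.+1) ^+ 2.
have q0 n : 0 < q n by rewrite exprn_gt0// invr_gt0 exprn_gt0.
have /choice[s_ sx] : forall n, exists s, `|x - embed H s| < q n / 2.
  by move=> n; apply: embed_approx; rewrite divr_gt0.
pose X n : tempered_cyl R -> R := pairing (s_ n).
have mX n : measurable_fun setT (X n) by exact: measurable_pairing.
have X_cvg : {ae P, forall w, cvgn (X ^~ w)}.
  apply: (@ae_cvgn_summable_increments _ _ _ P X 2) => // n.
  have -> : 2 / (2 ^ n.+1)%:R = (2 ^- n.+1 : R) *+ 2.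
    by rewrite mulr_natl natrX.
  apply: integral_norm_le_sqr.
  - exact: measurable_funB.
  - by rewrite invr_gt0 exprn_gt0//= invf_le1 ?exprn_gt0// exprn_ege1// ler1n.
  - rewrite integral_sqr_pairingB lee_fin lerXn2r ?nnegrE ?(ltW (q0 n))//.
    rewrite -(subrKA x) (le_trans (ler_normD _ _))// distrC.
    have := sx n; have := sx n.+1.
    have : q n.+1 <= q n.
      rewrite /q lerXn2r ?nnegrE ?invr_ge0 ?exprn_ge0//.
      rewrite lef_pV2 ?posrE ?exprn_gt0//.
      by rewrite ler_weXn2l// ler1n.
    rewrite -/(q n); lra.
(* The upper limit is measurable everywhere and equals the limit where the sequence converges; the
   other values concern a null set only. *)
pose Z w := fine (limn_esup (fun n => (X n w)%:E)).
have mZ : measurable_fun setT Z.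
  apply: (measurableT_comp (fine_measurable measurableT)).
  by apply: measurable_fun_limn_esup => n; exact/measurable_EFinP.
exists Z => // s.
apply: (@ae_fatou_cvg _ _ _ P (fun n w => (X n w - pairing s w) ^+ 2) _
    (fun n => `|embed H (s_ n) - embed H s| ^+ 2)).
- by move=> n; apply: measurable_funX; exact: measurable_sub_pairing.
- by apply: measurable_funX; exact: measurable_sub_pairing.
- by move=> n w; exact: sqr_ge0.
- by move=> w; exact: sqr_ge0.
- apply: filterS X_cvg => w /cvg_ex[l Xl].
  have -> : Z w = l.
    have Xl' : (X n w)%:E @[n --> \oo] --> l%:E.
      by apply: cvg_EFin => //; exact: nearW.
    by rewrite /Z is_cvg_limn_esupE ?(cvg_lim _ Xl')//;
      apply/cvg_ex; exists l%:E.
  under eq_fun do rewrite expr2; rewrite expr2.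
  by apply: cvgM; (apply: cvgB => //; exact: cvg_cst).
- by move=> n; rewrite integral_sqr_pairingB.
have sx_cvg : embed H (s_ n) @[n --> \oo] --> x.
  apply/cvgrPdist_lt => e e0; near=> n.
  (* The comparison chain is [q n / 2 <= q n <= 2 ^- n.+1 <= 1 / (n + 1)]. *)
  apply: (lt_trans (sx n)); apply: (@le_lt_trans _ _ (harmonic n)); last first.
    near: n; have /cvgrPdist_lt/(_ _ e0) := @cvg_harmonic R.
    by apply: filterS => n; rewrite sub0r normrN ger0_norm//= invr_ge0.
  apply: (@le_trans _ _ (q n)).
    by rewrite ler_pdivrMr// ler_peMr// ?ltW// ltr1n.
  apply: (@le_trans _ _ (2 ^- n.+1)).
    rewrite /q expr2 ler_piMr// invf_le1 ?exprn_gt0//.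
    by rewrite exprn_ege1// ler1n.
  rewrite /harmonic/= lef_pV2 ?posrE ?exprn_gt0 ?ltr0n// -natrX ler_nat.
  by rewrite ltnW// ltn_expl.
under eq_fun do rewrite expr2; rewrite expr2.
by apply: cvgM; apply: cvg_norm; (apply: cvgB => //; exact: cvg_cst).
Unshelve. all: by end_near. Qed.

Lemma exists_Q x : exists Z, is_Q P x Z.
Proof.
have [Z mZ ZX] := exists_L2_limit x; exists Z.
have ZN s : ('N[P]_2%:E[EFin \o (Z \- pairing s)%R] <= `|x - embed H s|%:E)%E.
  by apply: Lnorm2_le => //; exact: ZX.
split.
  apply: mem_Lfun2 => //; apply: le_lt_trans (ltry `|x - embed H 0|).
  (* The choice [s = 0] makes the pairing vanish and bounds the norm of [Z] itself. *)
  have := ZN 0; rewrite (_ : Z \- pairing 0 = Z)//.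
  by apply/funext => w /=; rewrite /pairing linear0 subr0.
move=> e e0; near=> y => s sy; apply: le_lt_trans (ZN s) _.
rewrite sy lte_fin; near: y; exact: cvgr_dist_lt.
Unshelve. all: by end_near. Qed.

Lemma Q_is_Q x : is_Q P x (Q P x).
Proof.
by have [Z QZ] := exists_Q x; exact: (xgetPex (cst 0) (ex_intro _ _ QZ)).
Qed.

(** A variant of [is_Q] that asks for a single good approximant at each scale. It passes to sums by
    adding approximants, and it is enough to determine the L^2 norm. *)
Definition L2_approximable x Z := forall e : R, 0 < e -> exists s,
  `|x - embed H s| < e /\ ('N[P]_2%:E[EFin \o (Z \- pairing s)%R] < e%:E)%E.

Lemma is_Q_approximable x Z : is_Q P x Z -> L2_approximable x Z.
Proof.
move=> [_ QZ] e e0; have /nbhs_ballP[r /= r0 xr] := QZ e e0.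
have [s sx] := embed_approx x (e := Order.min e r) ltac:(by rewrite lt_min e0).
move: sx; rewrite lt_min => /andP[sxe sxr]; exists s; split=> //.
by apply: (xr (embed H s)) => //; rewrite -ball_normE.
Qed.

Lemma L2_approximableD x y Z W :
  measurable_fun setT Z -> measurable_fun setT W ->
  L2_approximable x Z -> L2_approximable y W ->
  L2_approximable (x + y) (Z \+ W).
Proof.
move=> mZ mW xZ yW e e0.
have [s [xs Zs]] := xZ (e / 2) (divr_gt0 e0 (ltr0n _ 2)).
have [t [yt Wt]] := yW (e / 2) (divr_gt0 e0 (ltr0n _ 2)).
exists (s + t); split.
  rewrite linearD opprD addrACA (splitr e).
  by rewrite (le_lt_trans (ler_normD _ _))// ltrD.
have -> : (Z \+ W) \- pairing (s + t) = (Z \- pairing s) \+ (W \- pairing t).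
  by apply/funext => w /=; rewrite pairingD opprD addrACA.
rewrite (splitr e) EFinD; apply: le_lt_trans (lteD Zs Wt).
by apply: Lnorm2D; exact: measurable_sub_pairing.
Qed.

(** For an approximant [s], the pairing has L^2 norm [|embed H s|]; the triangle inequality in L^2
    and in [H] costs [e / 2] each, in both directions. *)
Lemma L2_approximable_norm x Z : measurable_fun setT Z -> L2_approximable x Z ->
  ('N[P]_2%:E[EFin \o Z] = `|x|%:E)%E.
Proof.
move=> mZ xZ; apply/eqP; rewrite eq_le.
apply/andP; split; apply/lee_addgt0Pr => e e0.
  have [s [xs Zs]] := xZ (e / 2) (divr_gt0 e0 (ltr0n _ 2)).
  rewrite (_ : Z = (Z \- pairing s) \+ pairing s); last first.
    by apply/funext => w /=; rewrite subrK.
  apply: le_trans (Lnorm2D P _ (measurable_pairing s)) _.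
    exact: measurable_sub_pairing.
  rewrite (Lnorm_pairing H hP) addeC [X in (_ <= _ + X%:E)%E]splitr.
  rewrite (EFinD (e / 2)) addeA.
  apply: leeD; last exact: ltW.
  rewrite -EFinD lee_fin; have := ler_normB (embed H s - x) (- x).
  rewrite opprK subrK distrC normrN; lra.
have [s [xs Zs]] := xZ (e / 2) (divr_gt0 e0 (ltr0n _ 2)).
have := Lnorm2D P mZ (measurable_pairing_sub s mZ).
rewrite (_ : Z \+ (pairing s \- Z) = pairing s); last first.
  by apply/funext => w /=; rewrite addrC subrK.
rewrite (Lnorm_pairing H hP) Lnorm2BC => ZN.
have {ZN} ZN : (`|embed H s|%:E <= 'N[P]_2%:E[EFin \o Z] + (e / 2)%:E)%E.
  by apply: (le_trans ZN); apply: leeD => //; exact: ltW.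
apply: (@le_trans _ _ (`|embed H s|%:E + (e / 2)%:E)%E).
  rewrite -EFinD lee_fin; have := ler_normD (x - embed H s) (embed H s).
  rewrite subrK; lra.
by rewrite [X in (_ <= _ + X%:E)%E]splitr (EFinD (e / 2)) addeA leeD2r.
Qed.

Lemma is_Q_norm x Z : is_Q P x Z -> ('N[P]_2%:E[EFin \o Z] = `|x|%:E)%E.
Proof.
move=> QZ; apply: L2_approximable_norm; last exact: is_Q_approximable.
exact: Lfun2_measurable QZ.1.
Qed.

(** Polarization: the norms of [Z], [W] and [Z + W] are those of [x], [y] and [x + y], the last one
    because approximability is additive. *)
Lemma is_Q_dot x y Z W : is_Q P x Z -> is_Q P y W ->
  \int[P]_w (Z w * W w) = hdot H x y.
Proof.
move=> QZ QW; have [LZ LW] := (QZ.1, QW.1).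
have [mZ mW] := (Lfun2_measurable LZ, Lfun2_measurable LW).
have N2 u (U : tempered_cyl R -> R) : ('N[P]_2%:E[EFin \o U] = `|u : H|%:E)%E ->
    \int[P]_w (U w ^+ 2) = `|u| ^+ 2.
  by move=> UE; rewrite /Rintegral (integral_sqr_Lnorm2 UE).
have EZ := N2 _ _ (is_Q_norm QZ); have EW := N2 _ _ (is_Q_norm QW).
have EZW : \int[P]_w ((Z \+ W) w ^+ 2) = `|x + y| ^+ 2.
  apply: N2; apply: L2_approximable_norm; first exact: measurable_funD.
  by apply: L2_approximableD => //; exact: is_Q_approximable.
have iZ := Lfun2_integrable_sqr LZ; have iW := Lfun2_integrable_sqr LW.
have iZW : P.-integrable setT (EFin \o (fun w => Z w * W w)).
  exact/Lfun1_integrable/Lfun2_mul_Lfun1.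
rewrite hdotE -EZ -EW -EZW.
have -> : \int[P]_w ((Z \+ W) w ^+ 2) =
    \int[P]_w (Z w ^+ 2) + (\int[P]_w (Z w * W w) + \int[P]_w (Z w * W w)) +
    \int[P]_w (W w ^+ 2).
  have iZW2 := integrableD measurableT iZW iZW.
  rewrite -(RintegralD _ iZW iZW)// -(RintegralD _ iZ iZW2)//.
  rewrite -(RintegralD _ (integrableD measurableT iZ iZW2) iW)//.
  by apply: eq_Rintegral => w _ /=; ring.
by field.
Qed.

(** The point [embed H s] lies in each of its own neighbourhoods, so [is_Q] bounds the L^2 distance
    to [pairing s] by every [e > 0]. *)
Lemma Q_embed_ae_eq (s : schwartz R) :
  ae_eq P setT (Q P (embed H s)) (pairing s).
Proof.
have [/Lfun2_measurable mQ Qs] := Q_is_Q (embed H s).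
have N0 : ('N[P]_2%:E[EFin \o (Q P (embed H s) \- pairing s)%R] = 0)%E.
  apply/eqP; rewrite eq_le Lnorm_ge0 andbT; apply/lee_addgt0Pr => e e0.
  by rewrite add0e; apply/ltW; apply: (nbhs_singleton (Qs e e0)).
have mQs := measurable_sub_pairing s mQ.
have := Lnorm_eq0_eq0 _ _ N0 => /(_ ((measurable_EFinP _ _).2 mQs) (ltr0n _ 2)).
by apply: filterS => w /(_ I) [] /eqP; rewrite subr_eq0 => /eqP.
Qed.

Lemma orthonormal_Q (I : countType) (g : I -> H) :
  orthonormal_basis g -> orthonormal_L2 P (fun n => Q P (g n)).
Proof.
move=> [gg _]; split=> [i|i j]; first exact: (Q_is_Q _).1.
by rewrite (is_Q_dot (Q_is_Q _) (Q_is_Q _)) gg.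
Qed.

End isometry.

(* Each seminorm vanishes on a proper subspace, and two proper subspaces do not
   cover the whole space. *)
Lemma exists_common_nonnull (R : realType)
    (sigma mu : {measure set (measurableTypeR R) -> \bar R})
    (H : hilbert_completion sigma) (K : hilbert_completion mu) :
  (exists x : H, x != 0) -> (exists y : K, y != 0) ->
  exists s, embed H s != 0 /\ embed K s != 0.
Proof.
have nonnull (nu : {measure set (measurableTypeR R) -> \bar R})
      (L : hilbert_completion nu) :
    (exists x : L, x != 0) -> exists s, embed L s != 0.
  move=> [x x0]; have nx : 0 < `|x| by rewrite normr_gt0.
  have [s xs] := embed_approx x nx.
  by exists s; apply: contraTneq xs => ->; rewrite subr0 ltxx.
move=> /nonnull[s Hs] /nonnull[t Kt].
have [Ks|Ks] := eqVneq (embed K s) 0; last by exists s.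
have [Ht|Ht] := eqVneq (embed H t) 0; last by exists t.
by exists (s + t); rewrite !linearD Ks Ht addr0 add0r.
Qed.

(** [Q Psigma x] is fixed only up to a [Psigma]-null set, so its law under [Pmu] may depend on the
    representative. The last clause therefore exhibits, for every pair of indices, basis vectors
    that are images of Schwartz functions: their pairings are canonical representatives, meaningful
    under both probabilities. *)
Theorem corollary5p2 (R : realType)
    (sigma mu : {measure set (measurableTypeR R) -> \bar R})
    (hsigma : admissible sigma) (hmu : admissible mu)
    (Psigma Pmu : probability (tempered_cyl R) R)
    (hPsigma : bochner_minlos sigma Psigma) (hPmu : bochner_minlos mu Pmu)
    (Hsigma : hilbert_completion sigma) (Hmu : hilbert_completion mu)
    (sepsigma : separable Hsigma) (sepmu : separable Hmu)
    (I J : countType) (g : I -> Hsigma) (h : J -> Hmu)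
    (hg : orthonormal_basis g) (hh : orthonormal_basis h) :
  [/\ orthonormal_L2 Psigma (fun n => Q Psigma (g n)),
      orthonormal_L2 Pmu (fun m => Q Pmu (h m)) &
      forall (n : I) (m : J),
      exists (g' : I -> Hsigma) (h' : J -> Hmu) (s t : schwartz R),
      [/\ orthonormal_basis g' /\ orthonormal_basis h',
          g' n = embed Hsigma s /\ h' m = embed Hmu t,
          ae_eq Psigma setT (Q Psigma (g' n)) (pairing s) /\
            ae_eq Pmu setT (Q Pmu (h' m)) (pairing t),
          ~ independent Psigma (pairing s) (pairing t) &
          ~ independent Pmu (pairing s) (pairing t)]].
Proof.
split; [exact: orthonormal_Q|exact: orthonormal_Q|move=> n m].
(* The indices [n] and [m] provide unit vectors, so neither Hilbert space is zero. *)
have basis_neq0 (nu : {measure set (measurableTypeR R) -> \bar R})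
    (L : hilbert_completion nu) (A : countType) (e : A -> L) (i : A) :
    orthonormal_basis e -> exists x : L, x != 0.
  move=> [ee _]; exists (e i); apply/eqP => ei0.
  by have := ee i i; rewrite ei0 linear0l eqxx => /eqP; rewrite eq_sym oner_eq0.
have [s0 [Hs0 Ks0]] := exists_common_nonnull (basis_neq0 _ _ _ _ n hg)
  (basis_neq0 _ _ _ _ m hh).
pose a := `|embed Hsigma s0|^-1; pose b := `|embed Hmu s0|^-1.
have a0 : a != 0 by rewrite invr_neq0// normr_eq0.
have b0 : b != 0 by rewrite invr_neq0// normr_eq0.
have norm1 (L : completeNormedModType R) (x : L) :
    x != 0 -> `| `|x|^-1 *: x| = 1.
  by move=> x0; rewrite normrZ normfV normr_id mulVf// normr_eq0.
have [g' [og' g'n]] := orthonormal_basis_through n hg (norm1 _ _ Hs0).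
have [h' [oh' h'm]] := orthonormal_basis_through m hh (norm1 _ _ Ks0).
(* One argument serves both probabilities: the two pairings are nonzero multiples of [pairing s0],
   whose variance is positive under each. *)
have dep (nu : {measure set (measurableTypeR R) -> \bar R})
    (L : hilbert_completion nu) (P : probability (tempered_cyl R) R) :
    bochner_minlos nu P -> embed L s0 != 0 ->
    ~ independent P (pairing (a *: s0)) (pairing (b *: s0)).
  move=> hP Ls0.
  have pE (c : R) : pairing (c *: s0) = (fun w => c * pairing s0 w).
    by apply/funext => w; rewrite pairingZ.
  rewrite !pE; apply: (not_independent_scaled (measurable_pairing s0)
    (expectation_cos_pairing L hP s0)) => //.
  by rewrite exprn_gt0// normr_gt0.
exists g', h', (a *: s0), (b *: s0).
have ga : g' n = embed Hsigma (a *: s0) by rewrite g'n linearZ.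
have hb : h' m = embed Hmu (b *: s0) by rewrite h'm linearZ.
split=> //; last 2 first.
- exact: dep hPsigma Hs0.
- exact: dep hPmu Ks0.
by rewrite ga hb; split; exact: Q_embed_ae_eq.
Qed.
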